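(* Let $k$ be a field, and let $\alpha = (\{X_g\}_{g\in G}, \{\alpha_g\}_{g\in G})$ be a partial action of a finite group $G$ on a finite set $X$. Let $\theta$ be the partial action of $G$ on $\mathrm{Fun}(X,k)$ induced by $\alpha$. Then the partial skew group algebra $\mathrm{Fun}(X,k)\rtimes_\theta G$ is a weak Hopf algebra over $k$, with comultiplication, counit and antipode the $k$-linear maps given, for $g\in G$ and $a\in\mathrm{Fun}(X,k)$ vanishing outside $X_g$, by $$\Delta(a\delta_g) = \sum_{x\in X_g} a(x)\,\chi_x\delta_g\otimes\chi_x\delta_g,\qquad \epsilon(a\delta_g) = \sum_{x\in X_g} a(x),\qquad S(a\delta_g) = \theta_{g^{-1}}(a)\,\delta_{g^{-1}},$$ where $\chi_x: X\to k$ denotes the characteristic function of $\{x\}$.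
   Context: **Partial action on a set.** A partial action $\alpha = (\{X_g\}_{g\in G}, \{\alpha_g\}_{g\in G})$ of a group $G$ (with neutral element $e$) on a set $X$ consists of subsets $X_g\subseteq X$ and bijections $\alpha_g: X_{g^{-1}}\to X_g$, one for each $g\in G$, such that (i) $X_e = X$ and $\alpha_e = \mathrm{Id}_X$; (ii) $(\alpha_h)^{-1}(X_{g^{-1}}\cap X_h)\subseteq X_{(gh)^{-1}}$ for all $g,h\in G$; (iii) $\alpha_g(\alpha_h(x)) = \alpha_{gh}(x)$ for all $g,h\in G$ and $x\in(\alpha_h)^{-1}(X_{g^{-1}}\cap X_h)$. **Induced partial action on functions.** $A=\mathrm{Fun}(X,k)$ is the $k$-algebra of functions $X\to k$ with pointwise operations. For $g\in G$, $A_g$ is the ideal of functions vanishing outside $X_g$, and $\theta_g: A_{g^{-1}}\to A_g$ is the algebra isomorphism given by $(\theta_g(f))(x) = f(\alpha_{g^{-1}}(x))$ for $f\in A_{g^{-1}}$ and $x\in X_g$ (and $(\theta_g(f))(x)=0$ for $x\notin X_g$). **Partial skew group algebra.** $A\rtimes_\theta G = \bigoplus_{g\in G} A_g\delta_g$ as a $k$-vector space (the $\delta_g$ being formal symbols), with multiplication determined by $(a\delta_g)(b\delta_h) = \theta_g(\theta_{g^{-1}}(a)\,b)\,\delta_{gh}$ for $a\in A_g$, $b\in A_h$; its unit is $1_A\delta_e$. **Weak Hopf algebra.** A weak Hopf algebra over $k$ is a unital associative $k$-algebra $H$ that is also a coassociative counital coalgebra $(H,\Delta,\epsilon)$, together with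 a linear map $S:H\to H$, such that (in Sweedler notation, with $\Delta(1)=1_{(1)}\otimes 1_{(2)}$), for all $x,y,z\in H$: $\Delta(xy)=\Delta(x)\Delta(y)$; $(\Delta\otimes \mathrm{Id})\Delta(1) = (\Delta(1)\otimes 1)(1\otimes\Delta(1)) = (1\otimes\Delta(1))(\Delta(1)\otimes 1)$; $\epsilon(xyz) = \epsilon(xy_{(1)})\epsilon(y_{(2)}z) = \epsilon(xy_{(2)})\epsilon(y_{(1)}z)$; $x_{(1)}S(x_{(2)}) = \epsilon(1_{(1)}x)1_{(2)}$; $S(x_{(1)})x_{(2)} = 1_{(1)}\epsilon(x1_{(2)})$; $S(x_{(1)})x_{(2)}S(x_{(3)}) = S(x)$. *)

(* Defs.v *)
From HB Require Import structures.
From mathcomp Require Import all_boot all_order all_algebra fingroup.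
From mathcomp Require Import boolp generic_quotient.

Set Implicit Arguments.
Unset Strict Implicit.
Unset Printing Implicit Defensive.

Import GRing.Theory.
Local Open Scope ring_scope.

(* The library's [algType] requires 1 != 0.  The skew group algebra of a
   partial action on the empty set is the zero algebra, so unital associative
   k-algebras are introduced here without that requirement. *)
HB.mixin Record Lmodule_isUAlgebra (k : pzRingType) A of GRing.Lmodule k A := {
  aone : A;
  amul : A -> A -> A;
  amulA : associative amul;
  amul1l : left_id aone amul;
  amul1r : right_id aone amul;
  amulDl : left_distributive amul +%R;
  amulDr : right_distributive amul +%R;
  amulZl : forall (c : k) (x y : A), amul (c *: x) y = c *: amul x y;
  amulZr : forall (c : k) (x y : A), amul x (c *: y) = c *: amul x y
}.

#[short(type="ualgType")]
HB.structure Definition UAlgebra (k : pzRingType) :=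
  {A of GRing.Lmodule k A & Lmodule_isUAlgebra k A}.

Arguments aone {k A} : rename.
Notation "x ** y" := (amul x y) (at level 40, left associativity) : ring_scope.

Section Tensor.
Variables (k : fieldType) (U V : lmodType k).

(* A sequence of pairs stands for the sum of the pure tensors u (x) v; the
   tensor product is the set of such formal sums modulo the congruence
   generated by commutativity and bilinearity.  Scalars, hence opposites, are
   absorbed by the left factors. *)
Inductive tensor_eq : seq (U * V) -> seq (U * V) -> Prop :=
| tensor_refl s : tensor_eq s s
| tensor_sym s t : tensor_eq s t -> tensor_eq t s
| tensor_trans s t r : tensor_eq s t -> tensor_eq t r -> tensor_eq s r
| tensor_cat s s' t t' :
    tensor_eq s s' -> tensor_eq t t' -> tensor_eq (s ++ t) (s' ++ t')
| tensor_catC s t : tensor_eq (s ++ t) (t ++ s)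
| tensor_0l v : tensor_eq [:: (0, v)] [::]
| tensor_Dl u u' v : tensor_eq [:: (u + u', v)] [:: (u, v); (u', v)]
| tensor_Dr u v v' : tensor_eq [:: (u, v + v')] [:: (u, v); (u, v')]
| tensor_Z c u v : tensor_eq [:: (c *: u, v)] [:: (u, c *: v)].

Definition tensor_eqb (s t : seq (U * V)) : bool := `[< tensor_eq s t >].

Lemma tensor_eqb_equiv : equiv_class_of tensor_eqb.
Proof.
split.
- by move=> s; apply/asboolP; exact: tensor_refl.
- by move=> s t; apply/asboolP/asboolP; exact: tensor_sym.
- move=> t s r /asboolP st /asboolP tr.
  by apply/asboolP; exact: tensor_trans st tr.
Qed.

Canonical tensor_equiv := EquivRelPack tensor_eqb_equiv.

Definition tensor : Type := {eq_quot tensor_equiv}%qT.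

HB.instance Definition _ := Choice.on tensor.
HB.instance Definition _ := EqQuotient.on tensor.

Local Notation pi := (\pi_tensor)%qT.

Lemma tensor_piP s t : tensor_eq s t <-> pi s = pi t.
Proof.
split=> [st|/eqP]; first by apply/eqP; rewrite eqmodE; apply/asboolP.
by rewrite eqmodE => /asboolP.
Qed.

Lemma tensor_repr s : tensor_eq (repr (pi s)) s.
Proof. by apply/tensor_piP; rewrite reprK. Qed.

Lemma tensorW (P : tensor -> Prop) : (forall s, P (pi s)) -> forall t, P t.
Proof. by move=> Ppi t; rewrite -[t]reprK; exact: Ppi. Qed.

Definition tpure (u : U) (v : V) : tensor := pi [:: (u, v)].

Definition tensor_add (s t : tensor) : tensor := pi (repr s ++ repr t).
Definition tensor_scale (c : k) (s : tensor) : tensor :=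
  pi [seq (c *: p.1, p.2) | p <- repr s].

Lemma tensor_add_pi s t : tensor_add (pi s) (pi t) = pi (s ++ t).
Proof. by apply/tensor_piP/tensor_cat; exact: tensor_repr. Qed.

Lemma tensor_eq_scale c s t : tensor_eq s t ->
  tensor_eq [seq (c *: p.1, p.2) | p <- s] [seq (c *: p.1, p.2) | p <- t].
Proof.
elim=> {s t}.
- by move=> s; exact: tensor_refl.
- by move=> s t _; exact: tensor_sym.
- by move=> s t r _ st _; exact: tensor_trans st.
- by move=> s s' t t' _ ss' _ tt'; rewrite !map_cat; exact: tensor_cat.
- by move=> s t; rewrite !map_cat; exact: tensor_catC.
- by move=> v; rewrite /= scaler0; exact: tensor_0l.
- by move=> u u' v; rewrite /= scalerDr; exact: tensor_Dl.
- by move=> u v v'; exact: tensor_Dr.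
- by move=> d u v; rewrite /= scalerA mulrC -scalerA; exact: tensor_Z.
Qed.

Lemma tensor_scale_pi c s :
  tensor_scale c (pi s) = pi [seq (c *: p.1, p.2) | p <- s].
Proof. by apply/tensor_piP/tensor_eq_scale; exact: tensor_repr. Qed.

Lemma tensor_addA : associative tensor_add.
Proof.
elim/tensorW=> s; elim/tensorW=> t; elim/tensorW=> r.
by rewrite !tensor_add_pi catA.
Qed.

Lemma tensor_addC : commutative tensor_add.
Proof.
elim/tensorW=> s; elim/tensorW=> t; rewrite !tensor_add_pi.
by apply/tensor_piP; exact: tensor_catC.
Qed.

Lemma tensor_add0 : left_id (pi [::]) tensor_add.
Proof. by elim/tensorW=> s; rewrite tensor_add_pi. Qed.

Lemma tensor_eq_scaleD a b s :
  tensor_eq [seq ((a + b) *: p.1, p.2) | p <- s]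
    ([seq (a *: p.1, p.2) | p <- s] ++ [seq (b *: p.1, p.2) | p <- s]).
Proof.
apply/tensor_piP; elim: s => //= -[u v] s IHs.
have piS x l : pi (x :: l) = tensor_add (pi [:: x]) (pi l).
  by rewrite tensor_add_pi.
rewrite (piS _ (map _ s)) IHs (piS _ (_ ++ _)) -!tensor_add_pi.
rewrite (piS _ (map _ s)) scalerDl.
have /tensor_piP -> := tensor_Dl (a *: u) (b *: u) v.
rewrite (piS _ [:: _]) -!tensor_addA; congr tensor_add.
by rewrite !tensor_addA; congr tensor_add; exact: tensor_addC.
Qed.

Lemma tensor_eq_scale0 s : tensor_eq [seq (0 *: p.1, p.2) | p <- s] [::].
Proof.
elim: s => [|[u v] s IHs] /=; first exact: tensor_refl.
by rewrite scale0r; exact: (tensor_cat (tensor_0l v) IHs).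
Qed.

Lemma tensor_scale1 : left_id 1 tensor_scale.
Proof.
elim/tensorW=> s; rewrite tensor_scale_pi; congr pi.
by rewrite -[RHS]map_id; apply: eq_map => -[u v] /=; rewrite scale1r.
Qed.

Lemma tensor_addN : left_inverse (pi [::]) (tensor_scale (-1)) tensor_add.
Proof.
move=> s; rewrite -{2}[s]tensor_scale1; elim/tensorW: s => s.
rewrite !tensor_scale_pi tensor_add_pi; apply/tensor_piP.
apply: tensor_trans (tensor_eq_scale0 s).
by apply: tensor_sym; rewrite -(addNr 1); exact: tensor_eq_scaleD.
Qed.

Lemma tensor_scaleDr c s t :
  tensor_scale c (tensor_add s t) =
  tensor_add (tensor_scale c s) (tensor_scale c t).
Proof.
elim/tensorW: s => s; elim/tensorW: t => t.
by rewrite tensor_add_pi !tensor_scale_pi tensor_add_pi map_cat.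
Qed.

Lemma tensor_scaleDl s a b :
  tensor_scale (a + b) s = tensor_add (tensor_scale a s) (tensor_scale b s).
Proof.
elim/tensorW: s => s; rewrite !tensor_scale_pi tensor_add_pi.
by apply/tensor_piP; exact: tensor_eq_scaleD.
Qed.

Lemma tensor_scaleA a b s :
  tensor_scale a (tensor_scale b s) = tensor_scale (a * b) s.
Proof.
elim/tensorW: s => s; rewrite !tensor_scale_pi -map_comp; congr pi.
by apply: eq_map => p /=; rewrite scalerA.
Qed.

HB.instance Definition _ := GRing.isZmodule.Build tensor
  tensor_addA tensor_addC tensor_add0 tensor_addN.

HB.instance Definition _ := GRing.Zmodule_isLmodule.Build k tensor
  tensor_scaleA tensor_scale1 tensor_scaleDr tensor_scaleDl.

End Tensor.

Notation "u \ox v" := (tpure u v) (at level 40, left associativity) : ring_scope.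

Section TensorTheory.
Variables (k : fieldType) (U V : lmodType k).

(* The map out of the tensor product induced by B, written for arbitrary B so
   that Sweedler expressions need no proofs; it is independent of the chosen
   representative when B is bilinear, see [tlift_pure] and [tlift_linear]. *)
Definition tlift (W : lmodType k) (B : U -> V -> W) (t : tensor U V) : W :=
  \sum_(p <- repr t) B p.1 p.2.

Lemma tlift_pi (W : lmodType k) (B : U -> V -> W) s :
  bilinear_for *:%R *:%R B ->
  tlift B (\pi_(tensor U V)%qT s) = \sum_(p <- s) B p.1 p.2.
Proof.
move=> [Bl Br].
have BDl u u' v : B (u + u') v = B u v + B u' v.
  by have := Bl v 1 u u'; rewrite /= !scale1r.
have BDr u v v' : B u (v + v') = B u v + B u v'.
  by have := Br u 1 v v'; rewrite /= !scale1r.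
have B0l v : B 0 v = 0 by apply: (addrI (B 0 v)); rewrite -BDl !addr0.
have B0r u : B u 0 = 0 by apply: (addrI (B u 0)); rewrite -BDr !addr0.
have BZl c u v : B (c *: u) v = c *: B u v.
  by have := Bl v c u 0; rewrite /= !addr0 B0l addr0.
have BZr c u v : B u (c *: v) = c *: B u v.
  by have := Br u c v 0; rewrite /= !addr0 B0r addr0.
rewrite /tlift; have := tensor_repr s.
move: {1 2}(repr _) => r; elim=> {s r} //.
- by move=> s t r _ -> _.
- by move=> s s' t t' _ e _ e'; rewrite !big_cat /= e e'.
- by move=> s t; rewrite !big_cat /= addrC.
- by move=> v; rewrite big_seq1 big_nil.
- by move=> u u' v; rewrite big_seq1 big_cons big_seq1 BDl.
- by move=> u v v'; rewrite big_seq1 big_cons big_seq1 BDr.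
- by move=> c u v; rewrite !big_seq1 /= BZl BZr.
Qed.

Lemma tlift_pure (W : lmodType k) (B : U -> V -> W) u v :
  bilinear_for *:%R *:%R B -> tlift B (u \ox v) = B u v.
Proof. by move=> Bb; rewrite tlift_pi // big_seq1. Qed.

Lemma tlift_linear (W : lmodType k) (B : U -> V -> W) :
  bilinear_for *:%R *:%R B -> linear (tlift B).
Proof.
move=> Bb c; elim/tensorW=> s; elim/tensorW=> t.
rewrite [c *: _]tensor_scale_pi [_ + _ in LHS]tensor_add_pi !tlift_pi //.
rewrite big_cat big_map scaler_sumr; congr (_ + _).
apply: eq_bigr => -[u v] _ /=; case: Bb => Bl _.
have B0 : B 0 v = 0.
  by have := Bl v (-1) 0 0; rewrite /= scaler0 addr0 scaleN1r addNr.
by have := Bl v c u 0; rewrite /= !addr0 B0 addr0.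
Qed.

Lemma tpure_bilinear : bilinear_for *:%R *:%R (@tpure k U V).
Proof.
have ZP c u v : c *: (u \ox v) = (c *: u) \ox v by exact: tensor_scale_pi.
split=> [v c u u'|u c v v'] /=; rewrite ZP.
  rewrite [RHS]tensor_add_pi; apply/tensor_piP; exact: tensor_Dl.
have -> : (c *: u) \ox v = u \ox (c *: v) by apply/tensor_piP; exact: tensor_Z.
by rewrite [RHS]tensor_add_pi; apply/tensor_piP; exact: tensor_Dr.
Qed.

Lemma tensor_ind_pure (P : tensor U V -> Prop) :
  P 0 -> (forall s t, P s -> P t -> P (s + t)) -> (forall u v, P (u \ox v)) ->
  forall t, P t.
Proof.
move=> P0 PD Pp; elim/tensorW; elim=> [|[u v] s IHs]; first exact: P0.
suff -> : \pi_(tensor U V)%qT ((u, v) :: s) = u \ox v + \pi_(tensor U V)%qT s.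
  by apply: PD.
by rewrite [RHS]tensor_add_pi.
Qed.

End TensorTheory.

Section TensorMaps.
Variable k : fieldType.

Definition tmap (U V U' V' : lmodType k) (f : U -> U') (g : V -> V') :
  tensor U V -> tensor U' V' := tlift (fun u v => f u \ox g v).

Definition tassoc (U V W : lmodType k) :
  tensor (tensor U V) W -> tensor U (tensor V W) :=
  tlift (fun t w => tlift (fun u v => u \ox (v \ox w)) t).

End TensorMaps.

Section TensorAlgebra.
Variables (k : fieldType) (A B : ualgType k).
Implicit Types s t r : tensor A B.

Definition tmul s t : tensor A B :=
  tlift (fun a b => tlift (fun c d => (a ** c) \ox (b ** d)) t) s.

Lemma tmul_inner_bilinear a b :
  bilinear_for *:%R *:%R (fun (c : A) (d : B) => (a ** c) \ox (b ** d)).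
Proof.
have [Pl Pr] := tpure_bilinear A B.
by split=> [d x c c'|c x d d'] /=; rewrite amulDr amulZr ?[LHS]Pl ?[LHS]Pr.
Qed.

Lemma tmul_linear_r s : linear (tmul s).
Proof.
move=> x t t'; rewrite /tmul /tlift scaler_sumr -big_split.
by apply: eq_bigr => p _; exact: (tlift_linear (tmul_inner_bilinear _ _)).
Qed.

Lemma tmul_outer_bilinear t : bilinear_for *:%R *:%R
  (fun (a : A) (b : B) => tlift (fun c d => (a ** c) \ox (b ** d)) t).
Proof.
have [Pl Pr] := tpure_bilinear A B.
split=> [b x a a'|a x b b'] /=; rewrite /tlift scaler_sumr -big_split;
  by apply: eq_bigr => p _; rewrite amulDl amulZl ?[LHS]Pl ?[LHS]Pr.
Qed.

Lemma tmul_linear_l t : linear (tmul ^~ t).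
Proof. by move=> x s s'; exact: (tlift_linear (tmul_outer_bilinear t)). Qed.

Lemma tmul_pure a b c d : tmul (a \ox b) (c \ox d) = (a ** c) \ox (b ** d).
Proof.
rewrite /tmul tlift_pure; last exact: tmul_outer_bilinear.
by rewrite tlift_pure //; exact: tmul_inner_bilinear.
Qed.

Lemma tmulDl : left_distributive tmul +%R.
Proof. by move=> s s' t; have := tmul_linear_l t 1 s s'; rewrite !scale1r. Qed.

Lemma tmulDr : right_distributive tmul +%R.
Proof. by move=> t s s'; have := tmul_linear_r t 1 s s'; rewrite !scale1r. Qed.

Lemma tmul0l t : tmul 0 t = 0.
Proof. by apply: (addrI (tmul 0 t)); rewrite -tmulDl !addr0. Qed.

Lemma tmul0r t : tmul t 0 = 0.
Proof. by apply: (addrI (tmul t 0)); rewrite -tmulDr !addr0. Qed.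

Lemma tmulZl c s t : tmul (c *: s) t = c *: tmul s t.
Proof. by have := tmul_linear_l t c s 0; rewrite !addr0 tmul0l addr0. Qed.

Lemma tmulZr c s t : tmul s (c *: t) = c *: tmul s t.
Proof. by have := tmul_linear_r s c t 0; rewrite !addr0 tmul0r addr0. Qed.

Lemma tmulA : associative tmul.
Proof.
move=> s t r; elim/tensor_ind_pure: s => [|s s' e e'|a b].
- by rewrite !tmul0l.
- by rewrite !tmulDl e e'.
elim/tensor_ind_pure: t => [|t t' e e'|c d].
- by rewrite tmul0l !tmul0r tmul0l.
- by rewrite tmulDl !tmulDr tmulDl e e'.
elim/tensor_ind_pure: r => [|r r' e e'|x y].
- by rewrite !tmul0r.
- by rewrite !tmulDr e e'.
by rewrite !tmul_pure !amulA.
Qed.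

Lemma tmul1l : left_id (aone \ox aone) tmul.
Proof.
elim/tensor_ind_pure=> [|t t' e e'|c d]; first by rewrite tmul0r.
  by rewrite tmulDr e e'.
by rewrite tmul_pure !amul1l.
Qed.

Lemma tmul1r : right_id (aone \ox aone) tmul.
Proof.
elim/tensor_ind_pure=> [|t t' e e'|c d]; first by rewrite tmul0l.
  by rewrite tmulDl e e'.
by rewrite tmul_pure !amul1r.
Qed.

HB.instance Definition _ := Lmodule_isUAlgebra.Build k (tensor A B)
  tmulA tmul1l tmul1r tmulDl tmulDr tmulZl tmulZr.

End TensorAlgebra.

(* Sweedler sums are written with [tlift]: the summand, as a function of the
   legs, is applied to the tensor.  Triple tensors are compared in
   H (x) (H (x) H). *)
Record is_weak_Hopf_algebra (k : fieldType) (H : ualgType k)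
    (Delta : {linear H -> tensor H H}) (eps : {scalar H})
    (S : {linear H -> H}) : Prop := IsWeakHopfAlgebra {
  wh_coassoc : forall x : H,
    tassoc (tmap Delta id (Delta x)) = tmap id Delta (Delta x);
  wh_counitl : forall x : H, tlift (fun x1 x2 => eps x1 *: x2) (Delta x) = x;
  wh_counitr : forall x : H, tlift (fun x1 x2 => eps x2 *: x1) (Delta x) = x;
  wh_comulM : forall x y : H, Delta (x ** y) = Delta x ** Delta y;
  wh_comul1 :
    tassoc (tmap Delta id (Delta aone)) =
      tassoc (Delta aone \ox aone) ** (aone \ox Delta aone);
  wh_comul1' :
    tassoc (tmap Delta id (Delta aone)) =
      (aone \ox Delta aone) ** tassoc (Delta aone \ox aone);
  wh_counitM : forall x y z : H,
    eps (x ** y ** z) =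
      tlift (fun y1 y2 => eps (x ** y1) * eps (y2 ** z) : k^o) (Delta y);
  wh_counitM' : forall x y z : H,
    eps (x ** y ** z) =
      tlift (fun y1 y2 => eps (x ** y2) * eps (y1 ** z) : k^o) (Delta y);
  wh_antipodel : forall x : H,
    tlift (fun x1 x2 => x1 ** S x2) (Delta x) =
      tlift (fun e1 e2 => eps (e1 ** x) *: e2) (Delta aone);
  wh_antipoder : forall x : H,
    tlift (fun x1 x2 => S x1 ** x2) (Delta x) =
      tlift (fun e1 e2 => eps (x ** e2) *: e1) (Delta aone);
  wh_antipode : forall x : H,
    tlift (fun t x3 => tlift (fun x1 x2 => S x1 ** x2 ** S x3) t)
      (tmap Delta id (Delta x)) = S x
}.

(* [pact g] stands for the bijection from X_{g^-1} to X_g.  It is used only on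
   X_{g^-1}; its values elsewhere are irrelevant. *)
Record partial_action (G : finGroupType) (X : finType) := PartialAction {
  pdom : G -> {set X};
  pact : G -> X -> X;
  pact_inj : forall g, {in pdom g^-1%g &, injective (pact g)};
  pact_im : forall g, [set pact g x | x in pdom g^-1%g] = pdom g;
  pdom1 : pdom 1%g = [set: X];
  pact1 : forall x, pact 1%g x = x;
  pdomM : forall g h x, x \in pdom h^-1%g ->
    pact h x \in pdom g^-1%g :&: pdom h -> x \in pdom (g * h)^-1%g;
  pactM : forall g h x, x \in pdom h^-1%g ->
    pact h x \in pdom g^-1%g :&: pdom h ->
    pact g (pact h x) = pact (g * h)%g x
}.

Section PartialSkewGroupAlgebra.
Variables (k : fieldType) (G : finGroupType) (X : finType).
Variable alpha : partial_action G X.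
Implicit Types (g h : G) (x y : X).

Local Notation Fun := {ffun X -> k^o}.

(* The ideal A_g.  Values are taken in k^o, the type k seen as a k-module, so
   that functions carry the pointwise scaling. *)
Definition pideal g : {pred Fun} :=
  fun a => [forall x, (x \notin pdom alpha g) ==> (a x == 0)].

(* theta_g, defined on all functions; it reads f only on X_{g^-1}. *)
Definition ptheta g (f : Fun) : Fun :=
  [ffun x => if x \in pdom alpha g then f (pact alpha g^-1%g x) else 0].

(* A family with components in the ideals A_g; since G is finite, these
   families form the direct sum of the A_g. *)
Definition pskew_pred : {pred {ffun G -> Fun}} :=
  fun u => [forall g, u g \in pideal g].

Record pskew :=
  PSkew { pskew_coef :> {ffun G -> Fun}; _ : pskew_coef \in pskew_pred }.

HB.instance Definition _ := [isSub for pskew_coef].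
HB.instance Definition _ := [Choice of pskew by <:].

Lemma pidealP g (a : Fun) :
  reflect (forall x, x \notin pdom alpha g -> a x = 0) (a \in pideal g).
Proof.
apply: (iffP forallP) => [ag x xg|ag x]; last by apply/implyP => /ag ->.
by have /implyP/(_ xg)/eqP := ag x.
Qed.

Lemma pskew_submod_closed : submod_closed pskew_pred.
Proof.
split=> [|c u v /forallP ug /forallP vg].
  by apply/forallP => g; apply/pidealP => x _; rewrite !ffunE.
apply/forallP => g; apply/pidealP => x xg.
by rewrite !ffunE (pidealP _ _ (ug g)) // (pidealP _ _ (vg g)) // scaler0 addr0.
Qed.

HB.instance Definition _ := GRing.isSubmodClosed.Build k {ffun G -> Fun} pskew_pred
  pskew_submod_closed.
HB.instance Definition _ := [SubChoice_isSubLmodule of pskew by <:].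

(* The element a delta_g when a is in A_g; in general the coefficient is the
   restriction of a to X_g, which makes the construction total and linear. *)
Definition pmono_coef g (a : Fun) : {ffun G -> Fun} :=
  [ffun h => if h == g then [ffun x => if x \in pdom alpha g then a x else 0]
             else 0].

Lemma pmono_subproof g a : pmono_coef g a \in pskew_pred.
Proof.
apply/forallP => h; apply/pidealP => x; rewrite ffunE.
by case: eqP => [->|_] xg; rewrite ffunE // (negPf xg).
Qed.

Definition pmono g a : pskew := PSkew (pmono_subproof g a).

(* (a delta_g) (b delta_h) = theta_g (theta_{g^-1} (a) b) delta_{gh}, extended
   bilinearly to the families u, v of components. *)
Definition pmul (u v : pskew) : pskew :=
  \sum_(g : G) \sum_(h : G)
    pmono (g * h)%g (ptheta g (ptheta g^-1%g (u g) * v h)).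

Definition pone : pskew := pmono 1%g 1.

Lemma pskewP (u v : pskew) : (forall g x, u g x = v g x) -> u = v.
Proof. by move=> uv; apply/val_inj/ffunP => g; apply/ffunP => x. Qed.

Lemma pskew_out (u : pskew) g x : x \notin pdom alpha g -> u g x = 0.
Proof.
by move=> xg; have /forallP/(_ g) := valP u; move=> /pidealP; apply.
Qed.

Lemma pskew0E g x : (0 : pskew) g x = 0.
Proof. by rewrite !ffunE. Qed.

Lemma pskewDE (u v : pskew) g x : (u + v) g x = u g x + v g x.
Proof. by rewrite !ffunE. Qed.

Lemma pskewZE c (u : pskew) g x : (c *: u) g x = c * u g x.
Proof. by rewrite !ffunE. Qed.

Definition pskewE := (pskew0E, pskewDE, pskewZE).

Lemma pskew_sumE (I : finType) (P : pred I) (F : I -> pskew) g x :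
  (\sum_(i | P i) F i) g x = \sum_(i | P i) F i g x.
Proof.
by elim/big_rec2: _ => [|i _ u _ <-]; rewrite pskewE.
Qed.

Lemma pmonoE g a h x :
  pmono g a h x = if (h == g) && (x \in pdom alpha g) then a x else 0.
Proof. by rewrite ffunE; case: eqP => //= _; rewrite ffunE. Qed.

Lemma pact_in g x :
  x \in pdom alpha g -> pact alpha g^-1%g x \in pdom alpha g^-1%g.
Proof. by move=> xg; rewrite -(pact_im alpha g^-1%g) imset_f ?invgK. Qed.

Lemma pactKV g x :
  x \in pdom alpha g -> pact alpha g (pact alpha g^-1%g x) = x.
Proof.
move=> xg; rewrite pactM ?invgK ?mulgV ?pact1 //.
by rewrite in_setI pact_in.
Qed.

Lemma pmulE (u v : pskew) g x :
  pmul u v g x = \sum_(h : G) u h x * v (h^-1 * g)%g (pact alpha h^-1%g x).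
Proof.
rewrite pskew_sumE; apply: eq_bigr => h _; rewrite pskew_sumE.
rewrite (bigD1 (h^-1 * g)%g) //= big1 ?addr0 => [|l lg]; last first.
  rewrite pmonoE; case: eqP => // e.
  by rewrite e mulgA mulVg mul1g eqxx in lg.
rewrite pmonoE mulKVg eqxx /= ffunE.
have [xh|xh] := boolP (x \in pdom alpha h); last first.
  by rewrite if_same pskew_out // mul0r.
have yh := pact_in xh.
rewrite ffunE ffunE yh invgK pactKV //.
case: ifPn => // xg; rewrite [X in _ * X]pskew_out ?mulr0 //.
apply: contraNN xg => yl.
have zl := pact_in yl; set y := pact _ _ x in yh yl zl.
have := @pdomM _ _ alpha (h^-1 * g)^-1%g h^-1%g x.
rewrite invgK -/y in_setI invgK yl yh => /(_ xh isT).
by rewrite -invMg invgK mulKVg.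
Qed.

Lemma pmulA : associative pmul.
Proof.
move=> u v w; apply: pskewP => g x; rewrite !pmulE.
under eq_bigr do rewrite pmulE mulr_sumr.
under [RHS]eq_bigr do rewrite pmulE mulr_suml.
rewrite [RHS]exchange_big /=; apply: eq_bigr => l _.
rewrite [RHS](reindex (fun m => l * m)%g) /=; last first.
  by exists (fun m => l^-1 * m)%g => m _; rewrite ?mulKg ?mulKVg.
apply: eq_bigr => m _; rewrite mulKg mulrA invMg -mulgA.
have [xl|/pskew_out ->] := boolP (x \in pdom alpha l); last by rewrite !mul0r.
have yl := pact_in xl.
have [ym|/pskew_out ->] := boolP (pact alpha l^-1%g x \in pdom alpha m); last first.
  by rewrite mulr0 !mul0r.
by rewrite pactM ?invgK // in_setI yl ym.
Qed.

Lemma pmul1l : left_id pone pmul.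
Proof.
move=> u; apply: pskewP => g x; rewrite pmulE (bigD1 1%g) //= big1 => [|h h1].
  by rewrite pmonoE eqxx pdom1 in_setT ffunE invg1 mul1g pact1 mul1r addr0.
by rewrite pmonoE (negPf h1) mul0r.
Qed.

Lemma pmul1r : right_id pone pmul.
Proof.
move=> u; apply: pskewP => g x; rewrite pmulE (bigD1 g) //= big1 => [|h hg].
  by rewrite mulVg pmonoE eqxx pdom1 in_setT ffunE mulr1 addr0.
by rewrite pmonoE -eq_mulVg1 (negPf hg) mulr0.
Qed.

Lemma pmulDl : left_distributive pmul +%R.
Proof.
move=> u v w; apply: pskewP => g x; rewrite pskewE !pmulE -big_split.
by apply: eq_bigr => h _; rewrite pskewE mulrDl.
Qed.

Lemma pmulDr : right_distributive pmul +%R.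
Proof.
move=> u v w; apply: pskewP => g x; rewrite pskewE !pmulE -big_split.
by apply: eq_bigr => h _; rewrite pskewE mulrDr.
Qed.

Lemma pmulZl c u v : pmul (c *: u) v = c *: pmul u v.
Proof.
apply: pskewP => g x; rewrite pskewE !pmulE mulr_sumr.
by apply: eq_bigr => h _; rewrite pskewE mulrA.
Qed.

Lemma pmulZr c u v : pmul u (c *: v) = c *: pmul u v.
Proof.
apply: pskewP => g x; rewrite pskewE !pmulE mulr_sumr.
by apply: eq_bigr => h _; rewrite pskewE mulrCA.
Qed.

HB.instance Definition _ := Lmodule_isUAlgebra.Build k pskew
  pmulA pmul1l pmul1r pmulDl pmulDr pmulZl pmulZr.

Lemma pmono_mul g h a b : a \in pideal g -> b \in pideal h ->
  pmono g a ** pmono h b = pmono (g * h)%g (ptheta g (ptheta g^-1%g a * b)).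
Proof.
move=> ag bh; have coefE l c : c \in pideal l -> pmono l c l = c.
  move=> cl; apply/ffunP => x; rewrite pmonoE eqxx /=.
  by case: ifPn => // /(pidealP _ _ cl) ->.
have coef0 l l' c : l' != l -> pmono l c l' = 0.
  by move=> ll'; apply/ffunP => x; rewrite pmonoE (negPf ll') ffunE.
have theta0 l : ptheta l 0 = 0.
  by apply/ffunP => x; rewrite !ffunE if_same.
have mono0 l : pmono l 0 = 0.
  by apply: pskewP => l' x; rewrite pmonoE pskew0E ffunE if_same.
rewrite [LHS](bigD1 g) //= [X in X + _](bigD1 h) //= !coefE //.
rewrite big1 => [|l lh]; last by rewrite coef0 // mulr0 theta0 mono0.
rewrite big1 ?addr0 // => l lg; rewrite big1 // => l' _.
by rewrite (coef0 g) // theta0 mul0r theta0 mono0.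
Qed.

Definition chi x : Fun := [ffun y => (y == x)%:R].

End PartialSkewGroupAlgebra.

(* Main.v *)
Require Import Defs.
From HB Require Import structures.
From mathcomp Require Import all_boot all_order all_algebra fingroup.

Import GRing.Theory.
Local Open Scope ring_scope.

(* The nonzero [arrow (g, x)], those with x in X_g, form a basis that multiplies
   like the arrows g^-1.x -> x of a finite groupoid with object set X, and the
   skew group algebra is the algebra of that groupoid.  On this basis Delta is
   diagonal, eps is 1 and S inverts arrows, so by linearity every axiom reduces
   to a computation with arrows. *)

(** * Linearity of maps built from tensors *)

Section TensorLemmas.
Set Implicit Arguments.
Unset Strict Implicit.
Variable k : fieldType.
Implicit Types U V W : lmodType k.

Lemma tpureDl U V (u u' : U) (v : V) : (u + u') \ox v = u \ox v + u' \ox v.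
Proof. by have := (tpure_bilinear U V).1 v 1 u u'; rewrite /= !scale1r. Qed.

Lemma tpureDr U V (u : U) (v v' : V) : u \ox (v + v') = u \ox v + u \ox v'.
Proof. by have := (tpure_bilinear U V).2 u 1 v v'; rewrite /= !scale1r. Qed.

Lemma tpure0l U V (v : V) : (0 : U) \ox v = 0.
Proof. by apply: (addrI ((0 : U) \ox v)); rewrite -tpureDl !addr0. Qed.

Lemma tpure0r U V (u : U) : u \ox (0 : V) = 0.
Proof. by apply: (addrI (u \ox (0 : V))); rewrite -tpureDr !addr0. Qed.

Lemma tpureZl U V c (u : U) (v : V) : (c *: u) \ox v = c *: (u \ox v).
Proof. by have := (tpure_bilinear U V).1 v c u 0; rewrite /= tpure0l !addr0. Qed.

Lemma tpureZr U V c (u : U) (v : V) : u \ox (c *: v) = c *: (u \ox v).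
Proof. by have := (tpure_bilinear U V).2 u c v 0; rewrite /= tpure0r !addr0. Qed.

(** Linearity is a hypothesis on a plain function because it will be applied to Sweedler expressions
    such as [tlift B], which carry no bundled linear structure. *)
Lemma linear_sumZ V W (f : V -> W) (I : finType) (c : I -> k) (v : I -> V) :
  linear f -> f (\sum_i c i *: v i) = \sum_i c i *: f (v i).
Proof.
move=> fl; have f0 : f 0 = 0.
  by have := fl (-1) 0 0; rewrite scaler0 addr0 scaleN1r addNr.
by elim/big_rec2: _ => // i _ w _ <-; exact: fl.
Qed.

Lemma linear_big V W (f : V -> W) (I : finType) (v : I -> V) :
  linear f -> f (\sum_i v i) = \sum_i f (v i).
Proof.
move=> fl; under eq_bigr do rewrite -[v _]scale1r.
by rewrite linear_sumZ //; apply: eq_bigr => i _; rewrite scale1r.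
Qed.

Lemma id_linear V : linear (@id V).
Proof. by []. Qed.

Lemma amul_linear_l (A : ualgType k) (v : A) : linear (fun u => u ** v).
Proof. by move=> c u u'; rewrite amulDl amulZl. Qed.

Lemma amul_linear_r (A : ualgType k) (u : A) : linear (fun v => u ** v).
Proof. by move=> c v v'; rewrite amulDr amulZr. Qed.

Lemma amul_pure (A B : ualgType k) (a c : A) (b d : B) :
  (a \ox b) ** (c \ox d) = (a ** c) \ox (b ** d).
Proof. exact: tmul_pure. Qed.

Lemma tpure_map_bilinear U V U' V' (f : U -> U') (g : V -> V') :
  linear f -> linear g -> bilinear_for *:%R *:%R (fun u v => f u \ox g v).
Proof.
move=> fl gl; split=> [v c u u'|u c v v'] /=.
  by rewrite fl tpureDl tpureZl.
by rewrite gl tpureDr tpureZr.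
Qed.

(** Serves nested Sweedler sums over three legs: the inner [tlift] consumes the first two legs while
    [w] is the third. *)
Lemma tlift_bilinear U V W W' (B : W -> U -> V -> W') :
    (forall w, bilinear_for *:%R *:%R (B w)) ->
    (forall u v, linear (fun w => B w u v)) ->
  bilinear_for *:%R *:%R (fun t w => tlift (B w) t).
Proof.
move=> Bb Bl; split=> [w|t c w w'] /=; first exact: tlift_linear.
(* Both sides sum over the same representative of [t], so linearity in [w] can be checked term by
   term. *)
rewrite /tlift scaler_sumr -big_split; apply: eq_bigr => p _; exact: Bl.
Qed.

Lemma tassoc_bilinear U V W : bilinear_for *:%R *:%R
  (fun (t : tensor U V) (w : W) => tlift (fun u v => u \ox (v \ox w)) t).
Proof.
apply: (@tlift_bilinear _ _ _ _ (fun w u v => u \ox (v \ox w))).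
  by move=> w; split=> [v c u u'|u c v v'] /=;
    rewrite !(tpureDl, tpureZl, tpureDr, tpureZr).
by move=> u v c w w'; rewrite !(tpureDr, tpureZr).
Qed.

Lemma tassoc_linear U V W : linear (@tassoc k U V W).
Proof. exact/tlift_linear/tassoc_bilinear. Qed.

Lemma tassoc_pure U V W (u : U) (v : V) (w : W) :
  tassoc (u \ox v \ox w) = u \ox (v \ox w).
Proof.
rewrite /tassoc tlift_pure ?tlift_pure //; last exact: tassoc_bilinear.
by split=> [v' c x x'|u' c x x'] /=;
  rewrite !(tpureDl, tpureZl, tpureDr, tpureZr).
Qed.

Lemma tmap_linear U V U' V' (f : U -> U') (g : V -> V') :
  linear f -> linear g -> linear (tmap f g).
Proof. by move=> fl gl; exact/tlift_linear/tpure_map_bilinear. Qed.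

Lemma tmap_pure U V U' V' (f : U -> U') (g : V -> V') u v :
  linear f -> linear g -> tmap f g (u \ox v) = f u \ox g v.
Proof. by move=> fl gl; rewrite /tmap tlift_pure //; exact: tpure_map_bilinear. Qed.

End TensorLemmas.

(** * The basis of arrows and its groupoid multiplication *)

Section ArrowBasis.
Set Implicit Arguments.
Unset Strict Implicit.
Variables (k : fieldType) (G : finGroupType) (X : finType).
Variable alpha : partial_action G X.

Local Notation H := (pskew k alpha).
Local Notation isarrow p := (p.2 \in pdom alpha p.1).

(** Defined on all pairs so that sums range over the finite type [G * X]; when [p.2] lies outside
    the domain of [p.1], the truncation in [pmono] makes it 0. *)
Definition arrow (p : G * X) : H := pmono alpha p.1 (chi k p.2).

(** The target of the arrow [p] is [p.2]; a product [p q] composes when the source of [p] is the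
    target of [q]. *)
Definition asource (p : G * X) : X := pact alpha p.1^-1%g p.2.
Definition ainv (p : G * X) : G * X := (p.1^-1%g, asource p).

Lemma arrowE p g x : arrow p g x = ((p == (g, x)) && isarrow p)%:R.
Proof.
case: p => h y; rewrite pmonoE ffunE xpair_eqE /= (eq_sym g) (eq_sym x).
case: eqP => //= -> ; case: (eqVneq y x) => [->|] /=; last by rewrite if_same.
by case: ifP.
Qed.

Lemma arrow_decomp (u : H) : u = \sum_p (u p.1 p.2 : k) *: arrow p.
Proof.
apply: pskewP => g x; rewrite pskew_sumE (bigD1 (g, x)) // big1 => [|p np].
  rewrite pskewZE arrowE eqxx /= addr0.
  by case: (boolP (x \in _)) => [_|/pskew_out ->]; rewrite ?mulr1 ?mul0r.
by rewrite pskewZE arrowE (negPf np) mulr0.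
Qed.

(** This is axiom (ii) of a partial action for the pair h^-1, g^-1 at x: since g^-1.x = y lies in
    X_h and in X_{g^-1}, x lies in X_{gh}. *)
Lemma isarrow_mul p q : isarrow p -> isarrow q -> asource p == q.2 ->
  p.2 \in pdom alpha (p.1 * q.1)%g.
Proof.
case: p q => [g x] [h y] /= xg yh /eqP e; rewrite /asource /= in e.
have := @pdomM _ _ alpha h^-1%g g^-1%g x.
by rewrite !invgK e in_setI yh -e pact_in // -invMg invgK; apply.
Qed.

(** Axiom (iii) for the same pair: h^-1.(g^-1.x) = (gh)^-1.x. *)
Lemma asource_mul p q : isarrow p -> isarrow q -> asource p == q.2 ->
  asource (p.1 * q.1, p.2)%g = asource q.
Proof.
case: p q => [g x] [h y] /= xg yh /eqP; rewrite /asource /= => e.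
by rewrite invMg -pactM ?e // !invgK // in_setI yh -e pact_in.
Qed.

Lemma isarrow_inv p : isarrow p -> isarrow (ainv p).
Proof. exact: pact_in. Qed.

Lemma asource_inv p : isarrow p -> asource (ainv p) = p.2.
Proof. by move=> Hp; rewrite /asource /= invgK pactKV. Qed.

Lemma arrow_mul p q : isarrow p -> isarrow q ->
  arrow p ** arrow q =
    if asource p == q.2 then arrow (p.1 * q.1, p.2)%g else 0.
Proof.
case: p q => [g x] [h y] /= xg yh; rewrite /asource /=.
(* In the convolution formula only the summand at g survives, because [arrow (g, x)] has no other
   component. *)
apply: pskewP => l z; rewrite [LHS]pmulE (bigD1 g) // big1; last first.
  by move=> l' lg; rewrite arrowE xpair_eqE eq_sym (negPf lg) mul0r.
rewrite !arrowE /= addr0 xg yh !andbT !xpair_eqE eqxx /=.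
have [<-|/negPf xz] := eqVneq x z; last first.
  by rewrite mul0r; case: ifP; rewrite ?pskew0E // arrowE xpair_eqE xz andbF.
rewrite mul1r [y == _]eq_sym; case: ifP => [e|_]; last by rewrite andbF pskew0E.
rewrite arrowE xpair_eqE eqxx !andbT (@isarrow_mul (g, x) (h, y)) // andbT.
by rewrite (can2_eq (mulKg g) (mulKVg g)).
Qed.

Lemma arrow_mulV p : isarrow p -> arrow p ** arrow (ainv p) = arrow (1%g, p.2).
Proof.
by move=> Hp; rewrite arrow_mul ?isarrow_inv // eqxx mulgV.
Qed.

Lemma arrow_mulVr p : isarrow p ->
  arrow (ainv p) ** arrow p = arrow (1%g, asource p).
Proof.
by move=> Hp; rewrite arrow_mul ?isarrow_inv // asource_inv // eqxx mulVg.
Qed.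

Lemma isarrow1 x : x \in pdom alpha 1%g.
Proof. by rewrite pdom1 in_setT. Qed.

Lemma arrow_mul1l x p : isarrow p ->
  arrow (1%g, x) ** arrow p = if x == p.2 then arrow p else 0.
Proof.
move=> Hp; rewrite arrow_mul ?isarrow1 // /asource /= invg1 pact1 mul1g.
by case: eqP => // ->; case: p {Hp}.
Qed.

Lemma arrow_mul1r x p : isarrow p ->
  arrow p ** arrow (1%g, x) = if asource p == x then arrow p else 0.
Proof. by move=> Hp; rewrite arrow_mul ?isarrow1 // mulg1; case: p {Hp}. Qed.

Lemma aone_arrow : aone = \sum_x arrow (1%g, x) :> H.
Proof.
apply: pskewP => g x; rewrite pskew_sumE (bigD1 x) // big1 => [|y yx].
  rewrite pmonoE ffunE arrowE isarrow1 xpair_eqE /= eqxx !andbT addr0 eq_sym.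
  by case: eqP.
by rewrite arrowE xpair_eqE (negPf yx) andbF.
Qed.

(** The reduction behind the axioms quantified over elements: in [arrow_decomp], pairs that are not
    arrows have coefficient 0, so agreement on arrows suffices. *)
Lemma linear_eq_arrow (W : lmodType k) (f f' : H -> W) :
    linear f -> linear f' ->
    (forall p, isarrow p -> f (arrow p) = f' (arrow p)) ->
  f =1 f'.
Proof.
move=> fl f'l ff' u; rewrite [u]arrow_decomp !linear_sumZ //.
apply: eq_bigr => p _; case: (boolP (isarrow p)) => [/ff' -> //|/pskew_out ->].
by rewrite !scale0r.
Qed.

(** Linear extension of [F] from the basis; a pair that is not an arrow enters with coefficient
    0. *)
Definition lext (W : lmodType k) (F : G * X -> W) (u : H) : W :=
  \sum_p (u p.1 p.2 : k) *: F p.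

Lemma lext_linear (W : lmodType k) (F : G * X -> W) : linear (lext F).
Proof.
move=> c u v; rewrite /lext scaler_sumr -big_split; apply: eq_bigr => p _.
by rewrite pskewDE pskewZE scalerDl -scalerA.
Qed.

HB.instance Definition _ (W : lmodType k) (F : G * X -> W) :=
  GRing.isLinear.Build k H W *:%R (lext F) (lext_linear F).

Lemma lext_pmono (W : lmodType k) (F : G * X -> W) g (a : {ffun X -> k^o}) :
  lext F (pmono alpha g a) = \sum_(x in pdom alpha g) (a x : k) *: F (g, x).
Proof.
transitivity (\sum_h \sum_x (pmono alpha g a h x : k) *: F (h, x)).
  by rewrite pair_bigA; apply: eq_bigr => -[].
rewrite (bigD1 g) //= [X in _ + X]big1 => [|h hg]; last first.
  by rewrite big1 // => x _; rewrite pmonoE (negPf hg) scale0r.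
rewrite addr0 [RHS]big_mkcond; apply: eq_bigr => x _ /=.
by rewrite pmonoE eqxx /=; case: ifP; rewrite ?scale0r.
Qed.

Lemma lext_arrow (W : lmodType k) (F : G * X -> W) p :
  isarrow p -> lext F (arrow p) = F p.
Proof.
move=> Hp; rewrite lext_pmono (bigD1 p.2) //= big1 => [|x /andP[_ xp]].
  by rewrite ffunE eqxx scale1r addr0; case: p {Hp}.
by rewrite ffunE (negPf xp) scale0r.
Qed.

End ArrowBasis.

(** * Comultiplication, counit and antipode *)

Section WeakHopf.
Set Implicit Arguments.
Unset Strict Implicit.
Variables (k : fieldType) (G : finGroupType) (X : finType).
Variable alpha : partial_action G X.

Local Notation H := (pskew k alpha).
Local Notation isarrow p := (p.2 \in pdom alpha p.1).
Local Notation arrow := (arrow k alpha).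
Local Notation ainv := (ainv alpha).

Definition pcomul : {linear H -> tensor H H} :=
  lext (fun p => arrow p \ox arrow p).
(** [lext] takes values in the module [k^o], while [{scalar H}] asks for a map to [k] that is linear
    for [*%R]; this copy carries the latter structure. *)
Definition pcounit_fun : H -> k := lext (fun=> 1 : k^o).
HB.instance Definition _ :=
  GRing.isLinear.Build k H k *%R pcounit_fun (lext_linear (fun=> 1 : k^o)).
Definition pcounit : {scalar H} := pcounit_fun.
Definition pantipode : {linear H -> H} := lext (fun p => arrow (ainv p)).

Lemma pcomul_arrow p : isarrow p -> pcomul (arrow p) = arrow p \ox arrow p.
Proof. exact: (lext_arrow (fun p => arrow p \ox arrow p)). Qed.

Lemma pcounit_arrow p : isarrow p -> pcounit (arrow p) = 1.
Proof. exact: (lext_arrow (fun=> 1 : k^o)). Qed.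

Lemma pantipode_arrow p : isarrow p -> pantipode (arrow p) = arrow (ainv p).
Proof. exact: (lext_arrow (fun p => arrow (ainv p))). Qed.

Lemma pantipode_pmono g (a : {ffun X -> k^o}) :
  pantipode (pmono alpha g a) = pmono alpha g^-1%g (ptheta alpha g^-1%g a).
Proof.
rewrite [LHS]lext_pmono; apply: pskewP => h y; rewrite pskew_sumE pmonoE ffunE.
under eq_bigr => x xg do
  rewrite pskewZE arrowE (isarrow_inv (p := (g, x))) // andbT xpair_eqE /=.
have [_|_] /= := eqVneq h; last by rewrite big1 // => x _; rewrite mulr0.
(* Sources of arrows over g lie in X_{g^-1}, so for y outside it every term vanishes. *)
case: ifPn => yg; last first.
  rewrite big1 // => x xg.
  have [e|_] := eqVneq (asource alpha (g, x)) y; last by rewrite mulr0.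
  by rewrite -e (isarrow_inv (p := (g, x))) in yg.
have xg := pact_in yg; rewrite invgK in xg *.
have yK := pactKV yg; rewrite invgK in yK.
(* The only x in X_g with g^-1.x = y is g.y. *)
rewrite (bigD1 (pact alpha g y)) //= big1 => [|x /andP[xg' /eqP ne]].
  by rewrite /asource /= yK eqxx mulr1 addr0 yg.
have [e|_] := eqVneq (asource alpha (g, x)) y; last by rewrite mulr0.
by case: ne; rewrite -e /asource /= pactKV.
Qed.

Lemma pcomul_linear : linear pcomul. Proof. exact: linearP. Qed.

Lemma tlift_pcomul_linear (W : lmodType k) (B : H -> H -> W) :
  bilinear_for *:%R *:%R B -> linear (fun u => tlift B (pcomul u)).
Proof. by move=> Bb c u v; rewrite linearP tlift_linear. Qed.

Lemma pcomul1 : pcomul aone = \sum_x arrow (1%g, x) \ox arrow (1%g, x).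
Proof.
rewrite aone_arrow linear_sum; apply: eq_bigr => x _.
by rewrite pcomul_arrow ?isarrow1.
Qed.

(** The common left side of the two axioms on Delta(1); the next two lemmas expand the factors on
    their right sides over identity arrows. *)
Lemma tassoc_comul1 : tassoc (tmap pcomul id (pcomul aone)) =
  \sum_x arrow (1%g, x) \ox (arrow (1%g, x) \ox arrow (1%g, x)).
Proof.
have tl := tmap_linear pcomul_linear (@id_linear k H).
rewrite pcomul1 (linear_big _ tl) (linear_big _ (@tassoc_linear _ _ _ _)).
apply: eq_bigr => x _; rewrite tmap_pure //; last exact: pcomul_linear.
by rewrite pcomul_arrow ?isarrow1 // tassoc_pure.
Qed.

Lemma tassoc_pcomul1_one : tassoc (pcomul aone \ox (aone : H)) =
  \sum_x arrow (1%g, x) \ox (arrow (1%g, x) \ox (aone : H)).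
Proof.
rewrite pcomul1 (@linear_big _ _ _ (fun t => tassoc (t \ox (aone : H)))).
  by apply: eq_bigr => x _; rewrite tassoc_pure.
by move=> c s t; rewrite tpureDl tpureZl tassoc_linear.
Qed.

Lemma one_pcomul1 : (aone : H) \ox pcomul aone =
  \sum_x (aone : H) \ox (arrow (1%g, x) \ox arrow (1%g, x)).
Proof.
rewrite pcomul1 (@linear_big _ _ _ (tpure (aone : H))) // => c s t.
by rewrite tpureDr tpureZr.
Qed.

(** Both sides are 1 if p, q and q, r are composable, and 0 otherwise: pq has the same source as q,
    so it composes with r exactly when q does. *)
Lemma pcounit_counitM p q r : isarrow p -> isarrow q -> isarrow r ->
  pcounit (arrow p ** arrow q ** arrow r) =
    pcounit (arrow p ** arrow q) * pcounit (arrow q ** arrow r).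
Proof.
move=> Hp Hq Hr; rewrite !arrow_mul //.
have amul0l (u : H) : (0 : H) ** u = 0.
  by apply: (addrI ((0 : H) ** u)); rewrite -amulDl !addr0.
case: ifP => pq; last by rewrite amul0l linear0 mul0r.
have Hpq : isarrow (p.1 * q.1, p.2)%g by exact: isarrow_mul pq.
rewrite arrow_mul // asource_mul //; case: ifP => qr; last by rewrite !linear0 mulr0.
rewrite !pcounit_arrow ?mulr1 //=; first exact: isarrow_mul qr.
by apply: (@isarrow_mul _ _ _ (p.1 * q.1, p.2)%g) => //; rewrite asource_mul.
Qed.

(** Since Delta of an arrow has equal legs, both axioms for eps of a triple product reduce to this
    identity. Linearity in [u] and [v] brings it down to arrows. *)
Lemma pcounit_mul_arrow q (u v : H) : isarrow q ->
  pcounit (u ** arrow q ** v) = pcounit (u ** arrow q) * pcounit (arrow q ** v).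
Proof.
move=> Hq; move: u.
apply: (@linear_eq_arrow _ _ _ _ k^o) => [c u u'|c u u'|p Hp].
- by rewrite !amulDl !amulZl linearP.
- by rewrite amulDl amulZl linearP mulrDl -mulrA.
move: v; apply: (@linear_eq_arrow _ _ _ _ k^o) => [c v v'|c v v'|r Hr].
- by rewrite amulDr amulZr linearP.
- by rewrite amulDr amulZr linearP mulrDr mulrCA.
exact: pcounit_counitM.
Qed.

(** * Verification of the weak Hopf axioms *)

Lemma pskew_weak_Hopf : is_weak_Hopf_algebra pcomul pcounit pantipode.
Proof.
have Dl := pcomul_linear.
have idl := @id_linear k H.
split.
- apply: linear_eq_arrow => [c u v|c u v|p Hp].
  + by rewrite Dl (tmap_linear Dl idl) tassoc_linear.
  + by rewrite Dl (tmap_linear idl Dl).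
  by rewrite pcomul_arrow // !tmap_pure // pcomul_arrow // tassoc_pure.
- have Bb : bilinear_for *:%R *:%R (fun x1 x2 : H => pcounit x1 *: x2).
    split=> [v c u u'|u c v v'] /=.
      by rewrite linearP scalerDl scalerA.
    by rewrite scalerDr !scalerA mulrC.
  apply: linear_eq_arrow => // [|p Hp]; first exact: tlift_pcomul_linear.
  by rewrite pcomul_arrow // tlift_pure // pcounit_arrow // scale1r.
- have Bb : bilinear_for *:%R *:%R (fun x1 x2 : H => pcounit x2 *: x1).
    split=> [v c u u'|u c v v'] /=.
      by rewrite scalerDr !scalerA mulrC.
    by rewrite linearP scalerDl scalerA.
  apply: linear_eq_arrow => // [|p Hp]; first exact: tlift_pcomul_linear.
  by rewrite pcomul_arrow // tlift_pure // pcounit_arrow // scale1r.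
- move=> x y; move: x; apply: linear_eq_arrow => [c u v|c u v|p Hp].
  + by rewrite amulDl amulZl Dl.
  + by rewrite Dl amulDl amulZl.
  move: y; apply: linear_eq_arrow => [c u v|c u v|q Hq].
  + by rewrite amulDr amulZr Dl.
  + by rewrite Dl amulDr amulZr.
  (* Either the arrows compose and the product is again an arrow, or both sides are 0. *)
  rewrite !pcomul_arrow // amul_pure !arrow_mul //; case: ifP => [pq|_].
    by rewrite pcomul_arrow //; exact: isarrow_mul pq.
  by rewrite linear0 tpure0l.
- rewrite tassoc_comul1 tassoc_pcomul1_one one_pcomul1.
  rewrite [RHS](linear_big _ (@amul_linear_l _ _ _)); apply: eq_bigr => x _.
  (* The middle legs multiply two identity arrows, and these are orthogonal idempotents, so the
     double sum collapses to its diagonal. *)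
  rewrite [RHS](linear_big _ (@amul_linear_r _ _ _)) (bigD1 x) //= big1 => [|y yx].
    by rewrite !amul_pure amul1r amul1l arrow_mul1l ?isarrow1 //= eqxx addr0.
  by rewrite !amul_pure arrow_mul1l ?isarrow1 //= eq_sym (negPf yx) tpure0l tpure0r.
- rewrite tassoc_comul1 tassoc_pcomul1_one one_pcomul1.
  rewrite [RHS](linear_big _ (@amul_linear_l _ _ _)); apply: eq_bigr => x _.
  rewrite [RHS](linear_big _ (@amul_linear_r _ _ _)) (bigD1 x) //= big1 => [|y yx].
    by rewrite !amul_pure amul1r amul1l arrow_mul1l ?isarrow1 //= eqxx addr0.
  by rewrite !amul_pure arrow_mul1l ?isarrow1 //= eq_sym (negPf yx) tpure0l tpure0r.
- move=> x y z; move: y.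
  have Bb : bilinear_for *:%R *:%R
      (fun y1 y2 : H => pcounit (x ** y1) * pcounit (y2 ** z) : k^o).
    split=> [v c u u'|u c v v'] /=.
      by rewrite amulDr amulZr linearP mulrDl -mulrA.
    by rewrite amulDl amulZl linearP mulrDr mulrCA.
  apply: (@linear_eq_arrow _ _ _ _ k^o) => [c u v||q Hq].
  + by rewrite amulDr amulZr amulDl amulZl linearP.
  + exact: tlift_pcomul_linear.
  by rewrite pcomul_arrow // tlift_pure // pcounit_mul_arrow.
- move=> x y z; move: y.
  have Bb : bilinear_for *:%R *:%R
      (fun y1 y2 : H => pcounit (x ** y2) * pcounit (y1 ** z) : k^o).
    split=> [v c u u'|u c v v'] /=.
      by rewrite amulDl amulZl linearP mulrDr mulrCA.
    by rewrite amulDr amulZr linearP mulrDl -mulrA.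
  apply: (@linear_eq_arrow _ _ _ _ k^o) => [c u v||q Hq].
  + by rewrite amulDr amulZr amulDl amulZl linearP.
  + exact: tlift_pcomul_linear.
  by rewrite pcomul_arrow // tlift_pure // pcounit_mul_arrow.
- have Bb : bilinear_for *:%R *:%R (fun x1 x2 : H => x1 ** pantipode x2).
    split=> [v c u u'|u c v v'] /=; first exact: amul_linear_l.
    by rewrite linearP amulDr amulZr.
  have Eb x : bilinear_for *:%R *:%R (fun e1 e2 : H => pcounit (e1 ** x) *: e2).
    split=> [v c u u'|u c v v'] /=.
      by rewrite amulDl amulZl linearP scalerDl scalerA.
    by rewrite scalerDr !scalerA mulrC.
  have E x : tlift (fun e1 e2 : H => pcounit (e1 ** x) *: e2) (pcomul aone) =
      \sum_y pcounit (arrow (1%g, y) ** x) *: arrow (1%g, y).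
    rewrite pcomul1 (linear_big _ (tlift_linear (Eb x))).
    by apply: eq_bigr => y _; rewrite tlift_pure.
  apply: linear_eq_arrow => [|c u v|p Hp]; first exact: tlift_pcomul_linear.
    rewrite !E scaler_sumr -big_split; apply: eq_bigr => y _.
    by rewrite amulDr amulZr linearP scalerDl scalerA.
  rewrite pcomul_arrow // tlift_pure // pantipode_arrow // arrow_mulV // E.
  (* On the left, p composes only with the identity at its target, which is also p p^-1. *)
  rewrite (bigD1 p.2) //= big1 => [|y yp]; rewrite arrow_mul1l //.
    by rewrite eqxx pcounit_arrow // scale1r addr0.
  by rewrite (negPf yp) linear0 scale0r.
- have Bb : bilinear_for *:%R *:%R (fun x1 x2 : H => pantipode x1 ** x2).
    split=> [v c u u'|u c v v'] /=; last exact: amul_linear_r.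
    by rewrite linearP amulDl amulZl.
  have Eb x : bilinear_for *:%R *:%R (fun e1 e2 : H => pcounit (x ** e2) *: e1).
    split=> [v c u u'|u c v v'] /=.
      by rewrite scalerDr !scalerA mulrC.
    by rewrite amulDr amulZr linearP scalerDl scalerA.
  have E x : tlift (fun e1 e2 : H => pcounit (x ** e2) *: e1) (pcomul aone) =
      \sum_y pcounit (x ** arrow (1%g, y)) *: arrow (1%g, y).
    rewrite pcomul1 (linear_big _ (tlift_linear (Eb x))).
    by apply: eq_bigr => y _; rewrite tlift_pure.
  apply: linear_eq_arrow => [|c u v|p Hp]; first exact: tlift_pcomul_linear.
    rewrite !E scaler_sumr -big_split; apply: eq_bigr => y _.
    by rewrite amulDl amulZl linearP scalerDl scalerA.
  rewrite pcomul_arrow // tlift_pure // pantipode_arrow // arrow_mulVr // E.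
  (* On the right, p composes only with the identity at its source, which is also p^-1 p. *)
  rewrite (bigD1 (asource alpha p)) //= big1 => [|y yp]; rewrite arrow_mul1r //.
    by rewrite eqxx pcounit_arrow // scale1r addr0.
  by rewrite eq_sym (negPf yp) linear0 scale0r.
- have Bb (w : H) : bilinear_for *:%R *:%R
      (fun x1 x2 : H => pantipode x1 ** x2 ** pantipode w).
    split=> [v c u u'|u c v v'] /=.
      by rewrite linearP !amulDl !amulZl.
    by rewrite amulDr amulZr amulDl amulZl.
  have Tb : bilinear_for *:%R *:%R (fun (t : tensor H H) (x3 : H) =>
      tlift (fun x1 x2 => pantipode x1 ** x2 ** pantipode x3) t).
    apply: tlift_bilinear => // x1 x2 c w w'.
    by rewrite linearP amulDr amulZr.
  apply: linear_eq_arrow => [c u v|c u v|p Hp]; last 1 first.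
  + rewrite pcomul_arrow // tmap_pure // tlift_pure // pcomul_arrow //.
    (* What remains is p^-1 p p^-1 = p^-1: the product p^-1 p is the identity at the source of p,
       which is the target of p^-1. *)
    rewrite tlift_pure // !pantipode_arrow // arrow_mulVr //.
    by rewrite arrow_mul1l ?isarrow_inv // eqxx.
  + by rewrite Dl (tmap_linear Dl idl) tlift_linear.
  by rewrite linearP.
Qed.

End WeakHopf.

Theorem mainTheorem2 (k : fieldType) (G : finGroupType) (X : finType)
    (alpha : partial_action G X) :
  exists (Delta : {linear pskew k alpha ->
                     tensor (pskew k alpha) (pskew k alpha)})
         (eps : {scalar pskew k alpha})
         (S : {linear pskew k alpha -> pskew k alpha}),
    (forall (g : G) (a : {ffun X -> k^o}), a \in pideal alpha g ->
       [/\ Delta (pmono alpha g a) =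
             \sum_(x in pdom alpha g)
               (a x : k) *: (pmono alpha g (chi k x) \ox pmono alpha g (chi k x)),
           eps (pmono alpha g a) = \sum_(x in pdom alpha g) (a x : k)
         & S (pmono alpha g a) =
             pmono alpha (g^-1)%g (ptheta alpha (g^-1)%g a)]) /\
    is_weak_Hopf_algebra Delta eps S.
Proof.
exists (pcomul k alpha), (pcounit k alpha), (pantipode k alpha).
split=> [g a _|]; last exact: pskew_weak_Hopf.
(* [arrow (g, x)] unfolds to [pmono alpha g (chi k x)], so [lext_pmono] is already the formula for
   Delta. *)
split; [exact: lext_pmono | | exact: pantipode_pmono].
(* Scaling in [k^o] is multiplication, so each summand reads [a x * 1]. *)
rewrite [LHS]lext_pmono; apply: eq_bigr => x _; exact: mulr1.
Qed.
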